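(* Every finite-dimensional space (that is, compact metrizable space of finite covering dimension) which is $e$-open is an absolute neighborhood retract (ANR).
   Context: ''Space'' means compact metrizable space and ''map'' means continuous function. A space pair is a pair $(Y,Z)$ where $Y$ is a space and $Z\subseteq Y$ is a closed subspace. For spaces $X,Z$, $X^Z$ denotes the set of maps from $Z$ to $X$ with the topology of uniform convergence (equivalently, the compact-open topology). For a space pair $(Y,Z)$, $X^{Z\uparrow Y}\subseteq X^Z$ denotes the set of maps from $Z$ to $X$ which extend to a map from $Y$ to $X$. A space $X$ is $e$-open if, for every space pair $(Y,Z)$, the set $X^{Z\uparrow Y}$ is open in $X^Z$. A compact metrizable space $X$ is an ANR if, for every space pair $(Y,Z)$, every map from $Z$ to $X$ extends to a continuous map from some neighborhood of $Z$ in $Y$ to $X$. *)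

(* Defs.v *)
From HB Require Import structures.
From mathcomp Require Import all_boot all_order all_algebra.
From mathcomp Require Import all_classical all_reals all_analysis.

Set Implicit Arguments.
Unset Strict Implicit.
Unset Printing Implicit Defensive.

Import Order.TTheory GRing.Theory Num.Theory.

Local Open Scope classical_set_scope.
Local Open Scope ring_scope.
Local Open Scope card_scope.

Definition metrizable (R : realType) (T : topologicalType) : Prop :=
  exists d : T -> T -> R,
    [/\ forall x, d x x = 0,
        forall x y, d x y = 0 -> x = y,
        forall x y, d x y = d y x,
        forall y x z, d x z <= d x y + d y z
      & forall (x : T) (A : set T),
          nbhs x A <-> exists2 e, 0 < e & [set y | d x y < e] `<=` A].

Definition compact_metrizable (R : realType) (T : topologicalType) : Prop :=
  compact [set: T] /\ metrizable R T.

Definition open_cover (T : topologicalType) (C : set (set T)) : Prop :=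
  C `<=` open /\ \bigcup_(U in C) U = [set: T].

(* Every open cover has an open refinement of multiplicity at most n + 1;
   [`I_n.+1] is the set of naturals k < n + 1. *)
Definition covering_dim_le (T : topologicalType) (n : nat) : Prop :=
  forall C : set (set T), open_cover C ->
  exists D : set (set T),
    [/\ open_cover D,
        forall V, D V -> exists2 U, C U & V `<=` U
      & forall x, [set V | D V /\ V x] #<= `I_n.+1].

(* The empty space, of dimension -1, satisfies this with any n. *)
Definition finite_dimensional (T : topologicalType) : Prop :=
  exists n, covering_dim_le T n.

Definition space_pair (R : realType) (Y : topologicalType) (Z : set Y) : Prop :=
  compact_metrizable R Y /\ closed Z.

(* A closed subset Z, coerced to a type, carries the subspace topology, and
   [set_val : Z -> Y] is its inclusion. Maps have subtypes as their domains,
   rather than being total functions on Y continuous within a subset, because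
   the target X may be empty. *)
Definition extendable (X Y : topologicalType) (Z : set Y) :
    set (continuousType Z X) :=
  [set f | exists F : continuousType Y X, forall z : Z, F (set_val z) = f z].

Section e_open.

(* Equips [continuousType Z X], the set of maps from Z to X, with the
   compact-open topology; for Z compact and X metric it coincides with the
   topology of uniform convergence. *)
Import ArrowAsCompactOpen.

Definition e_open (R : realType) (X : topologicalType) : Prop :=
  forall (Y : topologicalType) (Z : set Y), space_pair R Z ->
    open (@extendable X Y Z).

End e_open.

Definition absolute_nbhd_retract (R : realType) (X : topologicalType) : Prop :=
  forall (Y : topologicalType) (Z : set Y), space_pair R Z ->
  forall f : continuousType Z X,
  exists2 U : set Y, set_nbhs Z U &
    exists g : continuousType U X,
      forall (z : Z) (u : U), set_val z = set_val u -> g u = f z.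

(* Main.v *)
From HB Require Import structures.
Require Import Defs.
From mathcomp Require Import all_boot all_order all_algebra finmap.
From mathcomp Require Import all_classical all_reals all_analysis.
From mathcomp Require Import lra.

Set Implicit Arguments.
Unset Strict Implicit.
Unset Printing Implicit Defensive.

Import Order.TTheory GRing.Theory Num.Theory.
Import numFieldNormedType.Exports.

Local Open Scope classical_set_scope.
Local Open Scope ring_scope.

(** Let X be compact metrizable, of dimension at most n, and e-open.

    Openness of the set of extendable maps is first upgraded to a uniform
    statement ([uniform_extension]): for each e > 0 there is r > 0 such that,
    whenever G : B -> X is continuous and f : A -> X is continuous and r-close
    to G on a closed A in B, the map f extends to B with values e-close to G.
    If this failed for some e, there would be counterexamples (A_i, B_i, f_i,
    G_i) with r = 1/(i+1). They are put together in one space pair: the graphs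
    of the G_i over the A_i are placed on the slices of {0, 1, ..., oo} x Y x X
    over the integers i, and they accumulate on the full slice over oo. The
    projection to X is defined on the whole space, and it is the uniform limit
    on the closed subset of the maps which, from slice n on, are given by the
    f_i. By e-openness one of those extends to the whole space. On the slice
    over oo the extension is the projection, so by compactness it is close to
    the projection on the slices over large i, and there it extends f_i within
    e of G_i: a contradiction.

    With constant maps G, this property says that maps of small diameter have
    extensions of small diameter. It allows a map to be built from a closed
    set N with a finite open cover of order at most n + 1, each member of which
    is assigned a point of X so that members which meet have close points
    ([skeleton_map]). The construction goes by induction over the skeleta of N:
    the k-th one consists of the points that lie in at most k members of the
    cover, and passing from k to k + 1 amounts to solving one extension problem
    for each set of k + 1 members, where the given map is close to a constant.
    Each step loses some precision, and there are only n + 1 steps. This is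
    where the finite dimension enters. The sets N themselves play the role of
    the nerve of the cover, so that no simplicial complex is needed.

    Finally let f : Z -> X be given on a closed Z in Y. Composing f with a
    nearest-point map Y -> Z gives a function h : Y -> X, continuous at the
    points of Z only ([nearest_extension]). The interiors of the preimages by h
    of the members of a fine cover of X, of order at most n + 1, have order at
    most n + 1 too and cover a closed neighborhood N of Z. The previous
    construction gives a continuous map g on N that is close to h, hence close
    to f on Z ([nearby_map]). As g extends from Z to N, so does the nearby map
    f, by [uniform_extension]. *)

(** * Metrics inducing a given topology *)

(** The metrics whose existence is asserted by [metrizable]. *)
Definition metric_on (R : realType) (T : topologicalType) (d : T -> T -> R) :=
  [/\ forall x, d x x = 0,
      forall x y, d x y = 0 -> x = y,
      forall x y, d x y = d y x,
      forall y x z, d x z <= d x y + d y z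
    & forall (x : T) (A : set T),
        nbhs x A <-> exists2 e, 0 < e & [set y | d x y < e] `<=` A].

Section metric_facts.
Context (R : realType) (T : topologicalType) (d : T -> T -> R).
Hypothesis md : metric_on d.

Let dxx x : d x x = 0. Proof. by case: md. Qed.
Let dC x y : d x y = d y x. Proof. by case: md. Qed.
Let dT y x z : d x z <= d x y + d y z. Proof. by case: md. Qed.

Lemma dist_ge0 x y : 0 <= d x y.
Proof. by have := dT y x x; rewrite dxx (dC y x); lra. Qed.

Lemma dist_gt0 x y : x <> y -> 0 < d x y.
Proof.
move=> xy; rewrite lt_neqAle dist_ge0 andbT; apply/eqP => /esym d0.
by apply: xy; case: md => _ + _ _ _; exact.
Qed.

Lemma near_dist x e : 0 < e -> \forall y \near x, d x y < e.
Proof. by move=> e0; case: md => _ _ _ _ nP; apply/nP; exists e. Qed.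

Lemma cvg_dist (U : Type) (F : set_system U) (f : U -> T) (l : T) : Filter F ->
  (forall e, 0 < e -> \forall u \near F, d l (f u) < e) -> f @ F --> l.
Proof.
move=> FF fl B; case: md => _ _ _ _ nP /nP[e e0 eB].
by apply: filterS (fl e e0) => u /eB.
Qed.

Lemma continuous_dist : continuous (fun p : T * T => d p.1 p.2).
Proof.
case=> x y; apply/cvgrPdist_lt => e e0.
have e20 : 0 < e / 2 by rewrite divr_gt0.
exists ([set z | d x z < e / 2], [set z | d y z < e / 2]).
  by split; exact: near_dist.
case=> x' y' /= [xx' yy'].
have := dT x' x y; have := dT y' x' y; have := dT x x' y'; have := dT y x y'.
rewrite (dC x' x) (dC y' y) => ? ? ? ?.
by rewrite ltr_norml; apply/andP; split; lra.
Qed.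

Lemma metric_on_hausdorff : hausdorff_space T.
Proof.
move=> x y clxy; apply/not_notP => xy.
have e0 : 0 < d x y / 2 by rewrite divr_gt0// dist_gt0.
have [z [/= xz yz]] := clxy _ _ (near_dist x e0) (near_dist y e0).
by have := dT z x y; rewrite (dC z y); lra.
Qed.

End metric_facts.

Lemma metrizable_hausdorff (R : realType) (T : topologicalType) :
  metrizable R T -> hausdorff_space T.
Proof. by case=> d md; exact: metric_on_hausdorff md. Qed.

Lemma metrizable_prod (R : realType) (S T : topologicalType) :
  metrizable R S -> metrizable R T -> metrizable R (S * T)%type.
Proof.
move=> [c mc] [d md]; exists (fun p q => c p.1 q.1 + d p.2 q.2).
have [c0 ci cC cT cN] := mc; have [d0 di dC dT dN] := md.
have cge := dist_ge0 mc; have dge := dist_ge0 md.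
split=> [x|[x1 x2] [y1 y2] /= e|x y|y x z|[x1 x2] A].
- by rewrite c0 d0 addr0.
- have := cge x1 y1; have := dge x2 y2 => ? ?.
  by congr (_, _); [apply: ci|apply: di]; lra.
- by rewrite cC dC.
- by have := cT y.1 x.1 z.1; have := dT y.2 x.2 z.2; lra.
split=> [[[B1 B2] /= [/cN[e1 e10 eB1] /dN[e2 e20 eB2]] BA]|[e e0 eA]].
  exists (Num.min e1 e2); first by rewrite lt_min e10.
  case=> y1 y2 /=; rewrite lt_min => /andP[? ?]; apply: BA; split => /=.
    by apply: eB1 => /=; have := dge x2 y2; lra.
  by apply: eB2 => /=; have := cge x1 y1; lra.
have e20 : 0 < e / 2 by rewrite divr_gt0.
exists ([set z | c x1 z < e / 2], [set z | d x2 z < e / 2]).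
  by split; [exact: (near_dist mc)|exact: (near_dist md)].
by case=> y1 y2 /= [? ?]; apply: eA => /=; lra.
Qed.

(** On a compact space, a continuous injection into the line is an embedding,
    and the metric of the line can be pulled back along it. The distance from
    [x] to the complement of a neighborhood is positive because it is
    attained. *)
Lemma compact_embed_metrizable (R : realType) (T : topologicalType)
    (w : T -> R) :
  compact [set: T] -> injective w -> continuous w -> metrizable R T.
Proof.
move=> cT wi wc; exists (fun x y => `|w x - w y|); split.
- by move=> x; rewrite subrr normr0.
- by move=> x y /normr0_eq0/subr0_eq/wi.
- by move=> x y; rewrite distrC.
- by move=> y x z; exact: ler_distD.
move=> x A; split=> [xA|[e e0 eA]]; last first.
  by apply: filterS eA _; have /cvgrPdist_lt := wc x; exact.
have cC : compact (~` A°).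
  apply: (subclosed_compact _ cT) => //.
  by apply: open_closedC; exact: open_interior.
have [C0|/set0P C0] := eqVneq (~` A°) set0.
  exists 1 => // y _; apply: interior_subset.
  by apply: contrapT => yA; have : (~` A°) y by []; rewrite C0.
have wxc : {within ~` A°, continuous (fun y => `|w x - w y|)}.
  apply: continuous_subspaceT => y.
  by apply: cvg_norm; apply: cvgB; [exact: cvg_cst|exact: wc].
have [c] := compact_EVT_min C0 cC wxc; rewrite inE => Cc cmin.
exists `|w x - w c|.
  rewrite normr_gt0 subr_eq0; apply/eqP => /wi xc; apply: Cc.
  by rewrite -xc.
move=> y /= yc; apply: interior_subset; apply: contrapT => yA.
by have := cmin y; rewrite inE => /(_ yA); rewrite leNgt yc.
Qed.

(** * The convergent sequence *)

Local Notation opcN := (one_point_compactification nat).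

Lemma nbhs_Some (i : nat) (A : set opcN) : A (Some i) -> nbhs (Some i : opcN) A.
Proof.
move=> Ai; have H : nbhs i (fun j : nat => A (Some j)); last exact: H.
by apply: (@filterS nat _ _ _ _ _ (discrete_set1 i)) => j ->.
Qed.

(** Compact subsets of the discrete space of naturals are bounded, so the
    neighborhoods of infinity contain all large integers. *)
Lemma near_None_Some (P : set opcN) :
  (\forall k \near (None : opcN), P k) -> \forall i \near \oo, P (Some i).
Proof.
case=> U [cU _] UP.
have : \forall i \near \oo, forall x, U x -> (x < i)%N.
  apply: (compact_near_coveringP _).1 cU _ _ _ _ _ => x Ux.
  exists ([set x], [set i | (x < i)%N]) => /=.
    by split => //; exact: nbhs_infty_gt.
  by case=> _ i /= [->].
apply: filterS => i Ui; apply: UP; left; exists i => // /Ui.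
by rewrite ltnn.
Qed.

Lemma nbhs_None (N : nat) (A : set opcN) :
  A None -> (forall i, (N <= i)%N -> A (Some i)) -> nbhs (None : opcN) A.
Proof.
move=> A0 AN; exists `I_N.
  by split; [exact/finite_compact/finite_II|exact: discrete_closed].
by move=> k [[i /= /negP] | ->//]; rewrite -leqNgt => iN <-; exact: AN.
Qed.

(** The sequence i |-> 1 / (i + 1), with limit 0, is a copy of this space in
    the line. *)
Lemma opcN_metrizable (R : realType) : metrizable R opcN.
Proof.
pose w (k : opcN) : R := if k is Some i then i.+1%:R^-1 else 0.
apply: (@compact_embed_metrizable _ _ w).
- exact: one_point_compactification_compact.
- case=> [i|] [j|] //=.
  + by move/invr_inj/eqP; rewrite eqr_nat => /eqP[->].
  + by move/eqP; rewrite invr_eq0 pnatr_eq0.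
  + by move/esym/eqP; rewrite invr_eq0 pnatr_eq0.
- move=> k; have F : Filter (one_point_nbhs k) by exact: (nbhs_filter (k : opcN)).
  apply/cvgrPdist_lt => e e0; case: k F => [i|] F.
    by apply: nbhs_Some; rewrite subrr normr0.
  have [N Ne] : exists N : nat, N.+1%:R^-1 < e.
    have [N _ /(_ N (leqnn N))] := near_infty_natSinv_lt (PosNum e0).
    by exists N.
  apply: (@nbhs_None N) => [|i Ni]; first by rewrite subrr normr0.
  rewrite sub0r normrN ger0_norm ?invr_ge0//; apply: le_lt_trans Ne.
  by rewrite lef_pV2 ?posrE// ler_nat.
Qed.

Lemma opcN_compact_metrizable (R : realType) : compact_metrizable R opcN.
Proof.
split; [exact: one_point_compactification_compact|exact: opcN_metrizable].
Qed.

(** * Uniform extension of nearby maps *)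

Section e_open_sequences.
Import ArrowAsCompactOpen.

(** A uniform limit is a limit in the compact-open topology: a compact set
    whose image by [h] is in an open set is covered by finitely many open sets
    on which [h] is nearly constant. *)
Lemma e_open_uniform_limit (R : realType) (X : topologicalType)
    (d : X -> X -> R) (Y : topologicalType) (Z : set Y)
    (h : continuousType Z X) (f : nat -> continuousType Z X) :
  metric_on d -> e_open R X -> space_pair R Z -> extendable h ->
  (forall e, 0 < e -> \forall n \near \oo, forall z, d (h z) (f n z) < e) ->
  \forall n \near \oo, extendable (f n).
Proof.
move=> md oX YZ exth fh; have [W oW WE] := oX Y Z YZ.
have Wh : W h by move: exth; rewrite -WE.
suff fcvg : (fun n => f n : Z -> X) @ \oo --> (h : Z -> X).
  have : nbhs (h : Z -> X) W by exact: open_nbhs_nbhs.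
  by move=> /fcvg; rewrite -WE; exact.
apply/compact_open_cvgP => K B cK oB hKB.
have : \forall n \near \oo, forall z, K z -> B (f n z).
  apply: (compact_near_coveringP _).1 cK _ _ _ _ _ => z Kz.
  have Bhz : nbhs (h z) B.
    by apply: open_nbhs_nbhs; split => //; apply: hKB; exists z.
  have [_ _ _ dT nP] := md; have [e e0 eB] := (nP _ _).1 Bhz.
  have e20 : 0 < e / 2 by rewrite divr_gt0.
  exists ([set z' | d (h z) (h z') < e / 2],
          [set n | forall z, d (h z) (f n z) < e / 2]) => /=.
    split; last exact: fh.
    exact: (@cts_fun _ _ h z _ (near_dist md _ e20)).
  case=> z' n /= [zz' hf]; apply: eB => /=.
  by have := hf z'; have := dT (h z') (h z) (f n z'); lra.
by apply: filterS => n Bn _ [z Kz <-]; exact: Bn.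
Qed.

End e_open_sequences.

Lemma closed_graph (S T : topologicalType) (A : set S) (G : S -> T) :
  hausdorff_space (S * T)%type -> compact A -> {within A, continuous G} ->
  closed [set q : S * T | A q.1 /\ q.2 = G q.1].
Proof.
move=> hST cA cG.
have -> : [set q : S * T | A q.1 /\ q.2 = G q.1] = (fun y => (y, G y)) @` A.
  apply/seteqP; split=> [[y x] /= [Ay ->]|_ [y Ay <-]]; last by [].
  by exists y.
apply: compact_closed => //; apply: continuous_compact cA => y.
apply: cvg_pair; last exact: cG.
exact: (continuous_subspaceT (fun y => @cvg_id _ (nbhs y))).
Qed.

Section extension.
Context (R : realType) (X : topologicalType) (d : X -> X -> R).
Hypotheses (md : metric_on d) (cX : compact [set: X]) (oX : e_open R X).
Context (Y : topologicalType).
Hypothesis cmY : compact_metrizable R Y.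

(** The sequence of extension problems is encoded in one space pair [(W, Z)].
    The graph of [G i] on [A i], rather than [A i] itself, is placed on the
    slice over i: this makes the projection to X a continuous map on all of
    [W] that restricts to every [G i], although the [G i] need not converge. *)
Lemma extension_of_close_maps (A B : nat -> set Y) (f G : nat -> Y -> X) e :
  0 < e -> (forall n, closed (A n)) -> (forall n, A n `<=` B n) ->
  (forall n, {within A n, continuous f n}) ->
  (forall n, {within B n, continuous G n}) ->
  (forall n y, A n y -> d (f n y) (G n y) < n.+1%:R^-1) ->
  \forall n \near \oo, exists F,
    [/\ {within B n, continuous F}, forall y, A n y -> F y = f n y
      & forall y, B n y -> d (F y) (G n y) < e].
Proof.
move=> e0 clA AB cf cG fG.
pose W := (opcN * (Y * X))%type.
pose Z : set W := [set p | if p.1 is Some i then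
  A i p.2.1 /\ p.2.2 = G i p.2.1 else True].
have cmX : compact_metrizable R X by split=> //; exists d.
have WZ : space_pair R Z.
  split.
    have [? ?] := opcN_compact_metrizable R; have [? ?] := cmY.
    have [? ?] := cmX; split; last by do 2?[apply: metrizable_prod].
    by rewrite -!setXTT; do 2?[apply: compact_setX].
  rewrite -[Z]setCK; apply: open_closedC.
  rewrite openE => -[[i|] q] nq; last by case: nq.
  have oG : open (~` [set q : Y * X | A i q.1 /\ q.2 = G i q.1]).
    apply: closed_openC; apply: closed_graph.
    - apply: (@metrizable_hausdorff R).
      exact: metrizable_prod cmY.2 cmX.2.
    - exact: subclosed_compact (clA i) cmY.1 _.
    - exact: continuous_subspaceW (AB i) (cG i).
  exists ([set Some i], ~` [set q : Y * X | A i q.1 /\ q.2 = G i q.1]).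
    by split => /=; [exact: nbhs_Some|exact: open_nbhs_nbhs].
  by case=> _ q' /= [-> nq'].
pose fn n (p : W) : X :=
  if p.1 is Some i then if (n <= i)%N then f i p.2.1 else p.2.2 else p.2.2.
have c21 : continuous (fun p : W => p.2.1).
  move=> p; apply: (@continuous_comp _ _ _ snd fst); first exact: cvg_snd.
  exact: cvg_fst.
have c22 : continuous (fun p : W => p.2.2).
  by move=> p; apply: (@continuous_comp _ _ _ snd snd); exact: cvg_snd.
have snd_near (p : W) r : 0 < r -> \forall q \near p, d p.2.2 q.2.2 < r.
  by move=> r0; exact: (c22 p _ (near_dist md _ r0)).
have fst_near (p : W) (K : set opcN) : nbhs p.1 K -> \forall q \near p, K q.1.
  exact: (@cvg_fst _ _ (nbhs p.1) (nbhs p.2)).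
have small r : 0 < r -> exists N, forall i, (N <= i)%N -> (i.+1%:R^-1 : R) < r.
  move=> r0; have [N _ Nr] := near_infty_natSinv_lt (PosNum r0).
  by exists N => i /Nr.
(* Where fn n differs from the projection, the point lies on a slice i >= n,
   and the distance is that of f i to G i. *)
have fn_snd n p : Z p -> forall r,
    (forall i, p.1 = Some i -> (n <= i)%N -> i.+1%:R^-1 < r) ->
    0 < r -> d p.2.2 (fn n p) < r.
  have [dxx _ dC _ _] := md.
  case: p => [[i|] q] Zq r ir r0; rewrite /fn /= ?dxx//.
  case: ifP => [ni|_]; rewrite ?dxx//; case: Zq => Aq ->.
  by rewrite dC; apply: lt_trans (ir i _ _); rewrite ?fG.
have cfn n : {within Z, continuous fn n}.
  apply/subspace_continuousP => p Zp; apply: (cvg_dist md) => r r0.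
  case: p Zp => [[i|] [y x]] Zp.
    have Si := fst_near (Some i, (y, x)) _ (@nbhs_Some i [set Some i] erefl).
    have [Ay xG] := Zp.
    have fy := (@subspace_continuousP _ _ _ _).1 (cf i) y Ay.
    have fyr := c21 (Some i, (y, x)) _ (fy _ (near_dist md _ r0)).
    have xr := snd_near (Some i, (y, x)) r r0.
    apply: filterS3 Si fyr xr => -[k [y' x']] /= -> fyy' xx' [Ay' _].
    by rewrite /from_subspace /fn /=; case: ifP => // _; exact: fyy'.
  have r20 : 0 < r / 2 by rewrite divr_gt0.
  have [N Nr] := small _ r20.
  have NN : nbhs (None : opcN) [set k | forall i, k = Some i -> (N <= i)%N].
    by apply: (@nbhs_None N) => [//|i Ni j [<-]].
  have kN := fst_near (None, (y, x)) _ NN.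
  have xr := snd_near (None, (y, x)) _ r20.
  apply: filterS2 kN xr => q /= kN xr Zq.
  rewrite /from_subspace {1}/fn /=; have [_ _ _ dT _] := md.
  have : d q.2.2 (fn n q) < r / 2 by apply: fn_snd => // i /kN /Nr.
  by have := dT q.2.2 x (fn n q); lra.
have hc : continuous ((fun p : W => p.2.2) \o set_val : Z -> X).
  by apply/(@subspace_sigL_continuousP _ Z); exact: continuous_subspaceT.
have fc n : continuous (fn n \o set_val : Z -> X).
  by apply/(@subspace_sigL_continuousP _ Z).
pose h : continuousType Z X := mkcts hc.
pose fh n : continuousType Z X := mkcts (fc n).
have exth : extendable h by exists (mkcts c22 : continuousType W X).
have hfh r : 0 < r -> \forall n \near \oo, forall z, d (h z) (fh n z) < r.
  move=> r0; have [N Nr] := small _ r0; exists N => // n /= Nn z.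
  apply: fn_snd => // [|i _ ni]; first exact: set_valP.
  exact/Nr/(leq_trans Nn).
have [n0 _ /(_ n0 (leqnn _)) [F FE]] := e_open_uniform_limit md oX WZ exth hfh.
have FZ p : Z p -> F p = fn n0 p.
  by move=> Zp; exact: (FE (exist _ p (mem_set Zp))).
have [dxx _ _ _ _] := md.
have dF : continuous (fun p : W => d (F p) p.2.2).
  move=> p; apply: (@continuous_comp _ _ _ (fun p : W => (F p, p.2.2))
    (fun z => d z.1 z.2)).
    by apply: cvg_pair; [exact: cts_fun|exact: c22].
  exact: (continuous_dist md).
(* F is the projection on the slice over infinity; the tube lemma bounds the
   difference on the neighboring slices. *)
have Fe : \forall k \near (None : opcN),
    [set: Y * X] `<=` [set q | d (F (k, q)) q.2 < e].
  have := @compact_setX _ _ _ _ cmY.1 cX.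
  rewrite setXTT => /compact_near_coveringP cYX.
  have := cYX opcN (nbhs (None : opcN)) (fun k q => d (F (k, q)) q.2 < e).
  move=> /(_ (nbhs_filter _)); apply => q _.
  have : \forall p \near ((None, q) : W), d (F p) p.2.2 < e.
    apply: (dF ((None, q) : W) [set r | r < e]) => /=.
    by rewrite FZ// /fn /= dxx; exact: lt_nbhsl.
  case=> -[K Q] /= [NK qQ] KQ; exists (Q, K) => // -[q' k] [? ?].
  exact: (KQ (k, q')).
have : \forall i \near \oo, (n0 <= i)%N by exists n0.
apply: filterS2 (near_None_Some Fe) => i Fi ni.
exists (fun y => F (Some i, (y, G i y))); split.
- have ci : continuous (fun q : Y * X => (Some i, q) : W).
    move=> q P [[K Q] [/= nK nQ] KQ]; apply: filterS nQ => q' Qq'.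
    by apply: KQ; split => //; exact: (@nbhs_singleton opcN _ _ nK).
  move=> y; apply: (@continuous_comp (subspace (B i)) (Y * X)%type X
    (fun y => (y, G i y)) (fun q => F (Some i, q))).
    apply: cvg_pair; last exact: cG.
    exact: (continuous_subspaceT (fun y => @cvg_id _ (nbhs y))).
  by apply: (@continuous_comp _ W X _ F); [exact: ci|exact: cts_fun].
- by move=> y Ay; rewrite FZ// /fn /= ni.
- by move=> y By; exact: (Fi (y, G i y)).
Qed.

(** A failure for every [r] would provide a sequence of counterexamples that
    contradicts [extension_of_close_maps]. *)
Lemma uniform_extension e : 0 < e -> exists2 r, 0 < r &
  forall (A B : set Y) (f G : Y -> X), closed A -> A `<=` B ->
    {within A, continuous f} -> {within B, continuous G} ->
    (forall y, A y -> d (f y) (G y) < r) ->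
  exists F, [/\ {within B, continuous F}, forall y, A y -> F y = f y
      & forall y, B y -> d (F y) (G y) < e].
Proof.
move=> e0; apply: contrapT => /forall2NP nr.
pose hyp r (t : set Y * set Y * (Y -> X) * (Y -> X)) :=
  let: (A, B, f, G) := t in
  [/\ closed A, A `<=` B, {within A, continuous f}, {within B, continuous G} &
    forall y, A y -> d (f y) (G y) < r].
pose conc (t : set Y * set Y * (Y -> X) * (Y -> X)) :=
  let: (A, B, f, G) := t in
  exists F, [/\ {within B, continuous F}, forall y, A y -> F y = f y
      & forall y, B y -> d (F y) (G y) < e].
have /choice[t tP] n : exists t, hyp n.+1%:R^-1 t /\ ~ conc t.
  have [|bad] := nr n.+1%:R^-1; first by rewrite invr_gt0 ltr0Sn.
  apply: contrapT => /forallNP nt; apply: bad => A B f G clA AB cf cG fG.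
  by apply: contrapT => nF; apply: (nt (A, B, f, G)).
have := @extension_of_close_maps (fun n => (t n).1.1.1) (fun n => (t n).1.1.2)
  (fun n => (t n).1.2) (fun n => (t n).2) e e0.
have tH n : hyp n.+1%:R^-1 ((t n).1.1.1, (t n).1.1.2, (t n).1.2, (t n).2).
  by case: (tP n); case: (t n) => -[[? ?] ?] ?.
have tC n : ~ conc ((t n).1.1.1, (t n).1.1.2, (t n).1.2, (t n).2).
  by case: (tP n); case: (t n) => -[[? ?] ?] ?.
case=> [n|n|n|n|n|N _ /(_ N (leqnn N))]; [by case: (tH n)..|].
exact: tC.
Qed.

End extension.

(** * Maps defined by an open cover of bounded order *)

Lemma closed_gluing (S T : topologicalType) (I : finType) (P : {pred I})
    (C : I -> set S) (g : S -> T) :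
  (forall i, i \in P -> closed (C i)) ->
  (forall i, i \in P -> {within C i, continuous g}) ->
  closed (\bigcup_(i in [set` P]) C i) /\
  {within \bigcup_(i in [set` P]) C i, continuous g}.
Proof.
move=> clC gC; rewrite bigcup_pred.
apply: (big_ind (fun A => closed A /\ {within A, continuous g})).
- by split; [exact: closed0|exact: continuous_subspace0].
- by move=> A B [clA gA] [clB gB]; split; [exact: closedU|exact: withinU_continuous].
- by move=> i Pi; split; [exact: clC|exact: gC].
Qed.

Section skeleton.
Context (Y : topologicalType) (I : finType) (V : I -> set Y) (N : set Y).
Hypotheses (oV : forall i, open (V i)) (clN : closed N).

(** For [y] in [N], the smallest simplex of the nerve whose face contains [y]. *)
Definition carrier (y : Y) : {set I} := [set i | `[< V i y >]]%SET.

Lemma carrierP y i : reflect (V i y) (i \in carrier y).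
Proof. by rewrite inE; exact: asboolP. Qed.

(** The preimage of a closed simplex under the map from [N] to the nerve given
    by a partition of unity whose members are nonzero exactly on the [V i]. *)
Definition face (S : {set I}) : set Y := [set y | N y /\ carrier y \subset S].

(** The preimage of the simplices with at most [k] vertices, hence of the
    skeleton of dimension [k - 1] of the nerve. *)
Definition skeleton (k : nat) : set Y := [set y | N y /\ (#|carrier y| <= k)%N].

Lemma closed_face S : closed (face S).
Proof.
have -> : face S = N `&` \bigcap_(i in [set i | i \notin S]) ~` V i.
  apply/seteqP; split=> y [Ny yS]; split => //.
    move=> i /= iS Viy; case/negP: iS.
    by apply: (fintype.subsetP yS); exact/carrierP.
  apply/fintype.subsetP => i /carrierP Viy; apply: contrapT => /negP iS.
  exact: (yS i iS).
by apply: closedI => //; apply: closed_bigI => i _; exact: open_closedC.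
Qed.

Lemma skeleton_faces k :
  skeleton k = \bigcup_(S in [set` [pred S : {set I} | (#|S| <= k)%N]]) face S.
Proof.
apply/seteqP; split=> [y [Ny yk]|y [S Sk [Ny yS]]].
  by exists (carrier y).
by split=> //; apply: leq_trans Sk; exact: subset_leq_card.
Qed.

Lemma closed_skeleton k : closed (skeleton k).
Proof.
rewrite skeleton_faces.
have [||//] := @closed_gluing Y Y _ [pred S : {set I} | (#|S| <= k)%N] face id.
  by move=> S _; exact: closed_face.
by move=> S _; apply: continuous_subspaceT => y; exact: cvg_id.
Qed.

(** Distinct faces with [k + 1] vertices meet inside [skeleton k], so the
    extensions to them can be chosen independently. *)
Lemma skeleton_extension (X : topologicalType) k (g : Y -> X)
    (F : {set I} -> Y -> X) :
  {within skeleton k, continuous g} ->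
  (forall S : {set I}, #|S| = k.+1 -> {within face S, continuous F S}) ->
  (forall (S : {set I}) y, #|S| = k.+1 -> face S y -> skeleton k y ->
    F S y = g y) ->
  exists g', [/\ {within skeleton k.+1, continuous g'},
    forall y, skeleton k y -> g' y = g y
    & forall y, N y -> #|carrier y| = k.+1 -> g' y = F (carrier y) y].
Proof.
move=> cg cF Fg.
pose g' y := if #|carrier y| == k.+1 then F (carrier y) y else g y.
have g'g y : skeleton k y -> g' y = g y.
  by case=> Ny yk; rewrite /g' ltn_eqF.
exists g'; split=> //; last by move=> y Ny yk; rewrite /g' yk eqxx.
rewrite skeleton_faces; apply: (closed_gluing _ _).2 => [S _|S].
  exact: closed_face.
rewrite inE leq_eqVlt => /predU1P[Sk|Sk].
  apply: (@subspace_eq_continuous _ _ _ (F S)); last exact: cF.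
  move=> y; rewrite inE => Sy; rewrite /from_subspace.
  have [Ny yS] := Sy; rewrite /g'; case: eqP => [yk|/eqP yk].
    by congr F; apply/esym/eqP; rewrite eqEcard yS yk Sk /=.
  apply: Fg => //; split=> //.
  by have := subset_leq_card yS; rewrite Sk leq_eqVlt (negbTE yk).
have sub : face S `<=` skeleton k.
  by move=> y [Ny yS]; split=> //; apply: leq_trans (subset_leq_card yS) _.
apply: (@subspace_eq_continuous _ _ _ g); last exact: continuous_subspaceW sub cg.
by move=> y; rewrite inE => /sub/g'g.
Qed.

End skeleton.

Section map_of_cover.
Context (R : realType) (X : topologicalType) (d : X -> X -> R).
Hypotheses (md : metric_on d) (cX : compact [set: X]) (oX : e_open R X).
Context (Y : topologicalType) (x0 : X).
Hypothesis cmY : compact_metrizable R Y.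

(** In the step from [k] to [k + 1], fix a vertex [i0] of a simplex [S]. On the
    part of the face of [S] in [skeleton k], the map is close to the points
    assigned to some vertices of [S], which are close to [x i0]. It is thus
    close to a constant, and [uniform_extension] provides an extension to the
    face that is close to [x i0], hence to the points of all the vertices of
    [S]. The precision [r] depends on [k] and [e] only, and this is what
    allows the cover to be chosen after [r]. *)
Lemma skeleton_map k e : 0 < e -> exists2 r, 0 < r &
  forall (I : finType) (V : I -> set Y) (x : I -> X) (N : set Y),
    (forall i, open (V i)) -> closed N -> (forall y, N y -> exists i, V i y) ->
    (forall y i j, N y -> V i y -> V j y -> d (x i) (x j) < r) ->
  exists g, {within skeleton V N k, continuous g} /\
    forall y i, skeleton V N k y -> V i y -> d (g y) (x i) < e.
Proof.
have [_ _ dC dT _] := md.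
elim: k e => [|k IH] e e0.
  exists 1 => // I V x N oV clN NV _.
  have V0 y : ~ skeleton V N 0 y.
    case=> /NV[i /carrierP Viy]; rewrite leqn0 cards_eq0 => /eqP y0.
    by rewrite y0 inE in Viy.
  exists (fun=> x0); split=> [|y i /V0//].
  by apply: continuous_subspaceT => y; exact: cvg_cst.
have e20 : 0 < e / 2 by rewrite divr_gt0.
have [r1 r10 ext] := uniform_extension md cX oX cmY e20.
have [|r2 r20 {}IH] := IH (Num.min e (r1 / 2)).
  by rewrite lt_min e0 divr_gt0.
exists (Num.min r2 (Num.min (r1 / 2) (e / 2))).
  by rewrite !lt_min r20 e20 divr_gt0.
move=> I V x N oV clN NV xr.
have [|g [cg gx]] := IH I V x N oV clN NV.
  move=> y i j Ny Vi Vj.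
  by have := xr y i j Ny Vi Vj; rewrite !lt_min => /andP[].
have /choice[F FP] (S : {set I}) : exists F, #|S| = k.+1 ->
  [/\ {within face V N S, continuous F},
    forall y, face V N S y -> skeleton V N k y -> F y = g y
    & forall y i, N y -> carrier V y = S -> V i y -> d (F y) (x i) < e].
  have [Sk|Sk] := eqVneq #|S| k.+1; last first.
    by exists g => /eqP; rewrite (negbTE Sk).
  (* If no point has carrier S, the cover members in S need not meet and
     their points may be far apart, but the face of S is in the k-th skeleton. *)
  have [[y0 [Ny0 y0S]]|noy] := pselect (exists y, N y /\ carrier V y = S);
    last first.
    have sub : face V N S `<=` skeleton V N k.
      move=> y [Ny yS]; split=> //; rewrite -ltnS -Sk; apply: proper_card.
      rewrite finset.properEneq yS andbT.
      by apply/eqP => yeq; apply: noy; exists y.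
    exists g => _; split=> //; first exact: continuous_subspaceW sub cg.
    by move=> y i Ny yS; case: noy; exists y.
  have [i0 i0S] : exists i0, i0 \in S by apply/set0Pn; rewrite -card_gt0 Sk.
  have xS i : i \in S -> d (x i) (x i0) < Num.min (r1 / 2) (e / 2).
    move: i0S; rewrite -y0S => /carrierP Vi0 /carrierP Vi.
    by have := xr _ _ _ Ny0 Vi Vi0; rewrite lt_min => /andP[].
  have [||||y [[Ny yS] yk]|F [cF Fg FG]] :=
    ext (face V N S `&` skeleton V N k) (face V N S) g (cst (x i0)).
  - by apply: closedI; [exact: closed_face|exact: closed_skeleton].
  - by move=> y [].
  - exact: continuous_subspaceW (@subIsetr _ _ _) cg.
  - by apply: continuous_subspaceT => y; exact: cvg_cst.
  - have [i Vi] := NV _ Ny.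
    have := gx y i yk Vi; rewrite lt_min => /andP[_ ?].
    have := xS i; rewrite lt_min => /(_ (fintype.subsetP yS _ _)) /andP[].
      exact/carrierP.
    by move=> ? _; have := dT (x i) (g y) (x i0); rewrite /=; lra.
  exists F => _; split=> [//|y Sy ky|y i Ny yS Vi]; first exact: Fg.
  have /FG /= : face V N S y by split=> //; rewrite yS.
  have := xS i; rewrite lt_min -{1}yS => /(_ _)/andP[]; first exact/carrierP.
  by have := dT (x i0) (F y) (x i); rewrite (dC (x i0) (x i)); lra.
have [||g' [cg' g'g g'F]] := skeleton_extension oV clN (F := F) cg.
- by move=> S /FP[].
- by move=> S y /FP[_ FS _] Sy ky; exact: FS.
exists g'; split=> // y i [Ny]; rewrite leq_eqVlt => /predU1P[yk|yk] Vi.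
  by rewrite g'F//; have [_ _ Fx] := FP _ yk; exact: Fx.
by rewrite g'g//; have := gx y i (conj Ny yk) Vi; rewrite lt_min => /andP[].
Qed.

End map_of_cover.

(** * Approximation on a neighborhood *)

Lemma leq_card_inj (T : choiceType) (I : finType) (c : {set I}) (v : I -> T)
    (A : set T) n :
  injective v -> (forall i, i \in c -> A (v i)) -> (A #<= `I_n)%card ->
  (#|c| <= n)%N.
Proof.
move=> vi cA An; apply: leq_trans (geq_card_fset_set An).
have finA : finite_set A by apply/finite_set_leP; exists n.
have -> : #|c| = #|` [fset v i | i in c]%fset| by rewrite card_imfset//= -cardE.
apply: fsubset_leq_card; apply/fsubsetP => _ /imfsetP[i /= ic ->].
by rewrite in_fset_set//; apply/mem_set; exact: cA.
Qed.

(** The function [h] is [f \o p] for a nearest-point map [p : Y -> Z]. If [y] is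
    at distance less than e/2 from a point z of Z, then so is [p y] from [y],
    and [p y] is at distance less than e from z; this gives continuity at z. *)
Lemma nearest_extension (R : realType) (X Y : topologicalType) (Z : set Y)
    (f : continuousType Z X) :
  space_pair R Z -> Z !=set0 ->
  exists h : Y -> X, (forall z : Z, h (set_val z) = f z) /\
    forall y, Z y -> {for y, continuous h}.
Proof.
move=> [[cY [c mc]] clZ] Z0; have [cxx ci cC cT _] := mc.
have cZ : compact Z by apply: subclosed_compact cY _.
have /choice[p pP] y : exists p : Z,
    forall z : Z, c y (set_val p) <= c y (set_val z).
  have [|z] := @compact_EVT_min Y R (c y) Z Z0 cZ.
    apply: continuous_subspaceT => y'.
    apply: (@continuous_comp _ (Y * Y)%type _ (fun y' => (y, y'))
      (fun q => c q.1 q.2)).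
      by apply: cvg_pair; [exact: cvg_cst|exact: cvg_id].
    exact: continuous_dist.
  move=> /set_mem Zz zmin; exists (exist _ z (mem_set Zz)) => z'.
  by apply: zmin; apply/mem_set; exact: set_valP.
have pK z : p (set_val z) = z.
  apply/val_inj/esym/ci/eqP; rewrite eq_le (dist_ge0 mc) andbT.
  by have := pP (set_val z) z; rewrite cxx.
exists (f \o p); split=> [z|y Zy]; first by rewrite /= pK.
pose z : Z := exist _ y (mem_set Zy).
apply: continuous_comp; last exact: cts_fun.
have -> : y = set_val z by [].
move=> P; rewrite pK => -[_ [[W oW <-] /= Wz WP]].
have := open_nbhs_nbhs (conj oW Wz); have [_ _ _ _ nP] := mc.
move=> /nP[e e0 eW]; have e20 : 0 < e / 2 by rewrite divr_gt0.
apply: filterS (near_dist mc (set_val z) e20) => y' yy'; apply: WP; apply: eW => /=.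
have := pP y' z; have := cT y' (set_val z) (set_val (p y')).
by rewrite (cC y' (set_val z)); lra.
Qed.

(** Pulling back a cover of X by [h] does not increase its order, even though
    [h] is discontinuous, and the interiors of the pulled back sets still cover
    Z because [h] is continuous at the points of Z. *)
Lemma nearby_map (R : realType) (X : topologicalType) (d : X -> X -> R)
    (Y : topologicalType) (Z : set Y) (h : Y -> X) (n : nat) e :
  metric_on d -> compact [set: X] -> covering_dim_le X n -> e_open R X ->
  space_pair R Z -> Z !=set0 -> (forall y, Z y -> {for y, continuous h}) ->
  0 < e -> exists N g, [/\ set_nbhs Z N, closed N, {within N, continuous g}
    & forall y, N y -> d (h y) (g y) < e].
Proof.
move=> md cX dX oX [cmY clZ] [z0 Zz0] hc e0.
have [_ _ dC dT _] := md.
have e20 : 0 < e / 2 by rewrite divr_gt0.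
have [r r0 ext] := skeleton_map md cX oX (h z0) cmY n.+1 e20.
pose s := Num.min (r / 2) (e / 2).
have s20 : 0 < s / 2 by rewrite divr_gt0// lt_min e20 divr_gt0.
have [|D [[oD covD] Dsmall Dn]] := dX [set (fun y => d x y < s / 2)° | x in [set: X]].
  split; first by move=> _ [x _ <-]; exact: open_interior.
  apply/seteqP; split=> // x _; exists (fun y => d x y < s / 2)°; first by exists x.
  exact: (near_dist md).
have Ds V x y : D V -> V x -> V y -> d x y < s.
  move=> /Dsmall[_ [z _ <-] Vz] /Vz /interior_subset /= zx /Vz /interior_subset /= zy.
  by have := dT z x y; rewrite (dC x z); lra.
have [D' D'D covD'] : finite_subset_cover D id [set: X].
  (* X is nonempty here; the finite-subcover theorem is about pointed spaces. *)
  pose X' : ptopologicalType := HB.pack (Topological.sort X) (isPointed.Build X (h z0)).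
  have : @compact X' [set: X'] := cX.
  rewrite compact_cover; apply=> [U|]; first exact: oD.
  by rewrite -covD => x [U DU Ux]; exists U.
(* A point of each member of the cover; empty members get the value h z0. *)
have /choice[x xP] (i : D') : exists x, forall y, val i y -> val i x.
  have [[x ix]|nx] := pselect (exists x, val i x); first by exists x.
  by exists (h z0) => y iy; case: nx; exists y.
have DD (i : D') : D (val i) by exact/set_mem/(D'D _ (valP i)).
pose V (i : D') : set Y := (h @^-1` (val i))°.
have Vh i y : V i y -> val i (h y) by exact: interior_subset.
have oV i : open (V i) by exact: open_interior.
have oU : open (\bigcup_i V i) by apply: bigcup_open.
have ZU : Z `<=` \bigcup_i V i.
  move=> z Zz; have [U UD' Uhz] := covD' (h z) I.
  exists (FSetSub UD') => //; apply: hc => //=.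
  by apply: open_nbhs_nbhs; split=> //; apply: oD; exact: (DD (FSetSub UD')).
have [N ZN NU] : filter_from (set_nbhs Z) closure (\bigcup_i V i).
  have hY := metrizable_hausdorff cmY.2.
  apply: (compact_normal hY cmY.1 clZ).
  by move=> z /ZU Uz; exact: open_nbhs_nbhs.
have [y /NU[i _ Vi]||g [cg gx]] :=
    ext _ V x (closure N) oV (@closed_closure _ N).
- by exists i.
- move=> y i j _ /Vh hi /Vh hj.
  have := Ds _ _ _ (DD i) hi (xP i _ hi); have := Ds _ _ _ (DD j) hj (xP j _ hj).
  rewrite !lt_min => /andP[? _] /andP[? _].
  by have := dT (h y) (x i) (x j); rewrite (dC (x i) (h y)); lra.
have skN : closure N `<=` skeleton V (closure N) n.+1.
  move=> y Ny; split=> //; apply: (leq_card_inj _ _ (Dn (h y))); first exact: val_inj.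
  by move=> i /carrierP Vi; split; [exact: DD|exact: Vh].
exists (closure N), g; split.
- by move=> z /ZN; apply: filterS; exact: subset_closure.
- exact: closed_closure.
- exact: continuous_subspaceW skN cg.
move=> y Ny; have [i _ Vi] := NU _ Ny.
have := gx y i (skN _ Ny) Vi; have := dT (x i) (h y) (g y).
have := Ds _ _ _ (DD i) (Vh _ _ Vi) (xP i _ (Vh _ _ Vi)); rewrite lt_min => /andP[_].
by rewrite (dC (x i) (g y)); lra.
Qed.

(** * Finite-dimensional e-open spaces are ANRs *)

Theorem corollary4p4 (R : realType) (X : topologicalType) :
  compact_metrizable R X -> finite_dimensional X -> e_open R X ->
  absolute_nbhd_retract R X.
Proof.
move=> [cX [d md]] [n dX] oX Y Z YZ f.
(* X may be empty when Z is; the empty neighborhood then works. *)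
have [Z0|/set0P Z0] := eqVneq Z set0.
  exists set0; first by rewrite Z0 => x [].
  have ne (u : (set0 : set Y)) : False by have := set_valP u.
  have cg : continuous (fun u : (set0 : set Y) => False_rect X (ne u)).
    by move=> u; case: (ne u).
  exists (mkcts cg) => z u; case: (ne u).
have [h [hf hc]] := nearest_extension f YZ Z0.
have [r r0 ext] := uniform_extension md cX oX YZ.1 ltr01.
have [N [g [ZN clN cg hg]]] := nearby_map md cX dX oX YZ Z0 hc r0.
have NZ : Z `<=` N by move=> z /ZN; exact: nbhs_singleton.
have [|y Zy|F [cF Fh _]] := ext Z N h g YZ.2 NZ _ cg.
- by apply: continuous_in_subspaceT => y /set_mem; exact: hc.
- by apply: hg; exact: NZ.
have cF' : continuous (F \o set_val : N -> X) by apply/subspace_sigL_continuousP.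
exists N => //; exists (mkcts cF') => z u zu.
rewrite -hf -Fh; last exact: set_valP.
by rewrite zu.
Qed.
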